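(* Suppose that the component $y_k(t)$ of the solution of $y'(t)=f(y(t))$, $y(t_0)=\tilde y$, satisfies $y_k(t)\le M$ for $t\in[t_0,T]$, where $M\in\mathbb{R}$. Assume that the following conditions are met: (i) If $\Delta t_{FE}\le B_{FE}$ for some constant $B_{FE}\in\mathbb{R}^+$, then the forward Euler method with step size $\Delta t_{FE}$ applied to this problem preserves the boundedness property, namely $v^1_k\le M$ holds. (ii) For the starting values of the nonstandard multistep method $$u^{n+1}=\sum_{j=1}^s\left(\tilde\alpha_j u^{n+1-j}+\varphi(\Delta t)\,\tilde\beta_j f(u^{n+1-j})\right)$$ we have $u^0_k,u^1_k,\dots,u^{s-1}_k\le M$. (iii) $\varphi(x)\le\mathcal{C}B_{FE}$ for all $x\ge 0$, where $\mathcal{C}\in\mathbb{R}^+$ is the SSP coefficient defined as $\mathcal{C}=\min_j\tilde\alpha_j/\tilde\beta_j$. Then, for the nonstandard multistep method, $u^n_k\le M$ also holds for $n=s,\dots,\mathcal{N}$ for any step size $\Delta t\ge0$.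
   Context: Here $f:\mathbb{R}^m\to\mathbb{R}^m$, $\tilde y\in\mathbb{R}^m$, and the initial value problem is assumed to have a unique global solution $y=(y_1,\dots,y_m)^T$ on $[t_0,T]$. The forward Euler solution with step size $\Delta t_{FE}$ is denoted by $v^n=(v^n_1,\dots,v^n_m)^T$, so $v^{n+1}=v^n+\Delta t_{FE}f(v^n)$, and the solution of the explicit $s$-step nonstandard multistep method by $u^n=(u^n_1,\dots,u^n_m)^T$; both are started from $v^0=u^0=\tilde y$. A numerical solution $u^n$ is said to preserve the boundedness (from above) for the element $u^n_j$ if, in the case $u^0_j\le M$, one has $u^n_j\le M$ for every $n=1,2,\dots,\mathcal{N}$, where $\mathcal{N}$ is the index of the last time step. The coefficients satisfy $\tilde\alpha_j,\tilde\beta_j\ge0$, and if $\tilde\alpha_j=0$ then $\tilde\beta_j=0$; the method is consistent, so $\sum_{j=1}^s\tilde\alpha_j=1$. The function $\varphi$ is a nonnegative real-valued function of one variable. The minimum defining $\mathcal{C}$ is over the indices $j$ with $\tilde\beta_j\ne0$.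
   Formalization: Condition (i) is assumed for forward Euler started from every vector whose k-th component is at most M, not only from the given initial value; with the initial value alone the claim is false. *)

(* Defs.v *)
From HB Require Import structures.
From mathcomp Require Import all_boot all_order all_algebra.
From mathcomp Require Import boolp classical_sets reals.
From mathcomp Require Import topology normedtype.

Set Implicit Arguments.
Unset Strict Implicit.
Unset Printing Implicit Defensive.

Import Order.TTheory GRing.Theory Num.Theory.
Import numFieldNormedType.Exports.
Local Open Scope classical_set_scope.
Local Open Scope ring_scope.

(* The limit is taken along points of [t0, T] only, so the derivative is
   one-sided at the two endpoints. *)
Definition is_ivp_solution (R : realType) (m : nat)
    (f : 'cV[R]_m -> 'cV[R]_m) (t0 T : R) (yini : 'cV[R]_m)
    (y : R -> 'cV[R]_m) : Prop :=
  y t0 = yini /\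
  forall t : R, t0 <= t <= T ->
    (t' - t)^-1 *: (y t' - y t) @[t' --> within `[t0, T] t^'] --> f (y t).

Definition is_unique_ivp_solution (R : realType) (m : nat)
    (f : 'cV[R]_m -> 'cV[R]_m) (t0 T : R) (yini : 'cV[R]_m)
    (y : R -> 'cV[R]_m) : Prop :=
  is_ivp_solution f t0 T yini y /\
  forall z : R -> 'cV[R]_m, is_ivp_solution f t0 T yini z ->
    forall t : R, t0 <= t <= T -> z t = y t.

Definition forward_euler (R : realType) (m : nat)
    (f : 'cV[R]_m -> 'cV[R]_m) (dt : R) (v0 : 'cV[R]_m) (n : nat) : 'cV[R]_m :=
  iter n (fun v => v + dt *: f v) v0.

Definition preserves_boundedness (R : realType) (m : nat) (k : 'I_m) (M : R)
    (N : nat) (u : nat -> 'cV[R]_m) : Prop :=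
  u 0%N k 0 <= M -> forall n : nat, (1 <= n <= N)%N -> u n k 0 <= M.

(* The index i : 'I_s stands for j = i + 1, so that u^{n+1-j} is u (n - i);
   the subtraction never truncates because i < s <= n + 1. *)
Definition is_nonstandard_multistep (R : realType) (m s : nat)
    (alpha beta : 'I_s -> R) (phi : R -> R) (f : 'cV[R]_m -> 'cV[R]_m)
    (dt : R) (N : nat) (u : nat -> 'cV[R]_m) : Prop :=
  forall n : nat, (s <= n.+1 <= N)%N ->
    u n.+1 = \sum_(i < s) (alpha i *: u (n - i)%N
                           + (phi dt * beta i) *: f (u (n - i)%N)).

(* No C qualifies when every beta i vanishes: the minimum is then over an
   empty set. *)
Definition is_ssp_coefficient (R : realType) (s : nat)
    (alpha beta : 'I_s -> R) (C : R) : Prop :=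
  (exists2 i : 'I_s, beta i != 0 & C = alpha i / beta i) /\
  (forall i : 'I_s, beta i != 0 -> C <= alpha i / beta i).

(* Main.v *)
(* Each stage of the multistep method is alpha_j times a forward Euler step of
   size phi(dt) beta_j / alpha_j, which (iii) and the minimality of C bound by
   B_FE.  As the alpha_j are nonnegative and sum to 1, u^{n+1} is a convex
   combination of vectors whose k-th entry is at most M. *)

Require Import Defs.
From HB Require Import structures.
From mathcomp Require Import all_boot all_order all_algebra.
From mathcomp Require Import boolp classical_sets reals.
From mathcomp Require Import topology normedtype.

Set Implicit Arguments.
Unset Strict Implicit.
Unset Printing Implicit Defensive.

Import Order.TTheory GRing.Theory Num.Theory.
Import numFieldNormedType.Exports.
Local Open Scope classical_set_scope.
Local Open Scope ring_scope.

(** For [0 < b] the vector is [a] times the Euler step of size [b / a] from [v]. Stating the size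
    bound as [b <= a * B] also admits [a = 0], which then forces [b = 0]. *)
Lemma scaled_euler_step_le (R : realType) (m : nat)
    (f : 'cV[R]_m -> 'cV[R]_m) (k : 'I_m) (M B a b : R) (v : 'cV[R]_m) :
  (forall h : R, 0 < h -> h <= B ->
     forall v0 : 'cV[R]_m,
       preserves_boundedness k M 1 (forward_euler f h v0)) ->
  0 <= a -> 0 <= b -> b <= a * B -> v k 0 <= M ->
  (a *: v + b *: f v) k 0 <= a * M.
Proof.
move=> euler a_ge0 b_ge0 b_le v_le; rewrite !mxE.
(* [euler] covers positive step sizes only, so [b = 0] is treated apart. *)
have [->|b_neq0] := eqVneq b 0; first by rewrite mul0r addr0 ler_wpM2l.
have b_gt0 : 0 < b by rewrite lt_def b_neq0.
have a_gt0 : 0 < a.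
  rewrite lt_def a_ge0 andbT; apply/eqP => a0.
  by move: b_le; rewrite a0 mul0r leNgt b_gt0.
have h_le : b / a <= B by rewrite ler_pdivrMr // mulrC.
have /= := euler _ (divr_gt0 b_gt0 a_gt0) h_le v v_le 1%N isT.
rewrite !mxE -(ler_pM2l a_gt0) mulrDr mulrA.
by rewrite [a * (b / a)]mulrC divfK ?gt_eqF.
Qed.

Theorem theorem3 (R : realType) (m : nat)
    (f : 'cV[R]_m -> 'cV[R]_m) (t0 T : R) (yini : 'cV[R]_m)
    (y : R -> 'cV[R]_m) (k : 'I_m) (M : R)
    (s : nat) (alpha beta : 'I_s -> R) (phi : R -> R) (BFE C : R)
    (t0T : t0 < T)
    (y_sol : is_unique_ivp_solution f t0 T yini y)
    (y_le : forall t : R, t0 <= t <= T -> y t k 0 <= M)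
    (alpha_ge0 : forall i : 'I_s, 0 <= alpha i)
    (beta_ge0 : forall i : 'I_s, 0 <= beta i)
    (alpha_beta0 : forall i : 'I_s, alpha i = 0 -> beta i = 0)
    (alpha_sum1 : \sum_(i < s) alpha i = 1)
    (phi_ge0 : forall x : R, 0 <= x -> 0 <= phi x)
    (BFE_gt0 : 0 < BFE)
    (euler_bounded : forall dtFE : R, 0 < dtFE -> dtFE <= BFE ->
       forall v0 : 'cV[R]_m,
         preserves_boundedness k M 1 (forward_euler f dtFE v0))
    (C_gt0 : 0 < C)
    (C_ssp : is_ssp_coefficient alpha beta C)
    (phi_le : forall x : R, 0 <= x -> phi x <= C * BFE) :
  forall (dt : R) (N : nat) (u : nat -> 'cV[R]_m),
    0 <= dt ->
    u 0%N = yini ->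
    (forall n : nat, (n < s)%N -> u n k 0 <= M) ->
    is_nonstandard_multistep alpha beta phi f dt N u ->
    forall n : nat, (s <= n <= N)%N -> u n k 0 <= M.
Proof.
move=> dt N u dt_ge0 _ u_start u_step.
have stage_size i : phi dt * beta i <= alpha i * BFE.
  (* [C] is compared only with ratios whose denominator is nonzero. *)
  have [->|b_neq0] := eqVneq (beta i) 0.
    by rewrite mulr0 mulr_ge0 // ltW.
  have b_gt0 : 0 < beta i by rewrite lt_def b_neq0 beta_ge0.
  apply: (le_trans (ler_wpM2r (beta_ge0 i) (phi_le _ dt_ge0))).
  rewrite mulrAC ler_pM2r // -ler_pdivlMr //.
  exact: C_ssp.2.
(* The index attaining the minimum shows that ['I_s] is inhabited. *)
have s_gt0 : (0 < s)%N by have [[i _ _] _] := C_ssp; apply: leq_ltn_trans (ltn_ord i).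
elim/ltn_ind => -[|n] IHn /andP[sn nN]; first by rewrite leqNgt s_gt0 in sn.
(* Writing [M] as the sum of the [alpha i * M] reduces the bound to one inequality per stage. *)
rewrite u_step ?sn // summxE -[M]mul1r -alpha_sum1 mulr_suml.
apply: ler_sum => i _; apply: scaled_euler_step_le euler_bounded _ _ _ _ => //.
  by rewrite mulr_ge0 ?phi_ge0.
(* The earlier value is either a starting value or covered by the induction hypothesis, as
   [n - i < n.+1]. *)
have [/u_start //|s_le] := ltnP (n - i) s.
by apply: IHn; rewrite ?ltnS ?leq_subr // s_le (leq_trans (leq_subr _ _)) // ltnW.
Qed.
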